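(* Let $k \ge 2$. For every integer $n$, $$|S_n(12\ldots k,\ 132,\ 213)| = F_{k-1,n+1}.$$ Moreover, the generating function $f(x) = \sum_{n=0}^\infty |S_n(12\ldots k, 132, 213)|\, x^n$ is given by $$f(x) = \frac{1}{1 - x - x^2 - \cdots - x^{k-1}}.$$
   Context: Permutations of $[n]=\{1,\dots,n\}$ are written in one-line notation $\pi=\pi(1)\pi(2)\ldots\pi(n)$, and $S_n$ denotes the set of them. A permutation $\pi\in S_n$ contains $\sigma\in S_m$ if there are indices $i_1<\dots<i_m$ such that for all $a,b$, $\pi(i_a)<\pi(i_b)$ iff $\sigma(a)<\sigma(b)$; otherwise $\pi$ avoids $\sigma$. For a set $R$ of permutations, $S_n(R)$ is the set of $\pi\in S_n$ avoiding every element of $R$. By convention $S_0(R)$ consists of the empty permutation only, and $S_n(R)=\emptyset$ for $n<0$. Here $12\ldots k$ is the identity permutation of length $k$. For $k\ge 1$ the $k$-generalized Fibonacci numbers are defined by $F_{k,n}=0$ for $n\le 0$, $F_{k,1}=1$, and $F_{k,n}=\sum_{i=1}^k F_{k,n-i}$ for $n\ge 2$. *)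

(* Defs.v *)
From HB Require Import structures.
From mathcomp Require Import all_boot all_order all_algebra all_fingroup.
From mathcomp Require Import boolp.

Set Implicit Arguments.
Unset Strict Implicit.
Unset Printing Implicit Defensive.

Import Order.TTheory GRing.Theory Num.Theory.
Local Open Scope ring_scope.

(* A permutation of {1, ..., n} is pi : 'S_n, with indices and values shifted
   down by one. *)

Definition contains (n m : nat) (pi : 'S_n) (sigma : 'S_m) : bool :=
  [exists i : {ffun 'I_m -> 'I_n},
     [forall a : 'I_m, forall b : 'I_m, (a < b)%N ==> (i a < i b)%N]
     && [forall a : 'I_m, forall b : 'I_m,
          (pi (i a) < pi (i b))%N == (sigma a < sigma b)%N]].

Definition avoids (n m : nat) (pi : 'S_n) (sigma : 'S_m) : bool :=
  ~~ contains pi sigma.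

(* Permutations of arbitrary length, so that patterns of different lengths can
   be collected in one list. *)
Definition pattern : Type := {m : nat & 'S_m}.

Definition Pattern (m : nat) (sigma : 'S_m) : pattern :=
  existT (fun m => 'S_m) m sigma.

(* S_n(R) for an integer n: the ambient type is that of permutations of
   length |n|, and the set is empty when n < 0. *)
Definition Av (n : int) (R : seq pattern) : {set 'S_(`|n|%N)} :=
  [set pi | (0 <= n) && all (fun s : pattern => avoids pi (projT2 s)) R].

Definition id_pattern (k : nat) : 'S_k := 1%g.
Definition perm132 : 'S_3 := tperm (inord 1%N) (inord 2%N).
Definition perm213 : 'S_3 := tperm (inord 0%N) (inord 1%N).

Definition one_line (n : nat) (pi : 'S_n) : seq nat :=
  [seq (pi i : nat).+1 | i <- enum 'I_n].

Lemma id_pattern_one_line (k : nat) : one_line (id_pattern k) = iota 1%N k.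
Proof.
rewrite /one_line (eq_map (g := succn \o val)) => [|i]; last by rewrite perm1.
by rewrite map_comp val_enum_ord -(addn0 1%N) iotaDl.
Qed.

Lemma perm132_one_line : one_line perm132 = [:: 1; 3; 2]%N.
Proof.
by rewrite /one_line !enum_ordSl; case: (enum 'I_0) (size_enum_ord 0) => //= _;
   rewrite !permE /= -!val_eqE /= !inordK.
Qed.

Lemma perm213_one_line : one_line perm213 = [:: 2; 1; 3]%N.
Proof.
by rewrite /one_line !enum_ordSl; case: (enum 'I_0) (size_enum_ord 0) => //= _;
   rewrite !permE /= -!val_eqE /= !inordK.
Qed.

(* [:: F_{k,n}; ...; F_{k,1}].  Truncation of the sum by [take] is harmless
   since F_{k,j} = 0 for j <= 0; the recurrence is gfib_rec below. *)
Fixpoint gfib_seq (k n : nat) : seq nat :=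
  match n with
  | 0 => [::]
  | 1 => [:: 1%N]
  | n'.+1 => let s := gfib_seq k n' in sumn (take k s) :: s
  end.

Definition gfib (k : nat) (n : int) : nat :=
  if n is Posz m then head 0%N (gfib_seq k m) else 0%N.

Lemma gfib_le0 (k : nat) (n : int) : n <= 0 -> gfib k n = 0%N.
Proof. by case: n => [[|n]|n]. Qed.

Lemma gfib1 (k : nat) : gfib k 1 = 1%N.
Proof. by []. Qed.

Lemma size_gfib_seq (k n : nat) : size (gfib_seq k n) = n.
Proof. by elim: n => [|[|n] IH] //=; rewrite -[in RHS]IH. Qed.

Lemma nth_gfib_seq (k n i : nat) :
  nth 0%N (gfib_seq k n) i = gfib k (n%:Z - i%:Z).
Proof.
elim: n i => [|n IH] [|i]; first by [].
- by rewrite nth_nil gfib_le0 // subr_le0.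
- by rewrite subr0 nth0.
have -> : n.+1%:Z - i.+1%:Z = n%:Z - i%:Z.
  by rewrite !intS opprD addrACA subrr add0r.
by rewrite -IH; case: n {IH} => [|n] //=; rewrite nth_nil.
Qed.

Lemma gfib_rec (k : nat) (n : int) : 2 <= n ->
  gfib k n = (\sum_(1 <= i < k.+1) gfib k (n - i%:Z))%N.
Proof.
case: n => [[|[|n]]|n] // _.
rewrite big_add1 -[k.+1.-1]/k -[LHS]/(sumn (take k (gfib_seq k n.+1))).
rewrite sumnE (big_nth 0%N) size_take_min size_gfib_seq.
rewrite big_nat [RHS]big_nat.
rewrite (eq_bigr (fun i => nth 0%N (gfib_seq k n.+1) i)); last first.
  by move=> i /andP[_]; rewrite ltn_min => /andP[ik _]; rewrite nth_take.
rewrite -!big_nat.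
under [RHS]eq_bigr => i _.
  have -> : n.+2%:Z - i.+1%:Z = n.+1%:Z - i%:Z.
    by rewrite (intS n.+1) (intS i) opprD addrACA subrr add0r.
  rewrite -nth_gfib_seq; over.
have := size_gfib_seq k n.+1; move: (gfib_seq k n.+1) => s sz_s.
rewrite [RHS](big_cat_nat (n := minn k n.+1)) //=; last exact: geq_minl.
rewrite [X in (_ + X)%N]big_nat [X in (_ + X)%N]big1 ?addn0 // => i /andP[le_i lt_i].
apply: nth_default; rewrite sz_s.
by move: le_i; rewrite geq_min leqNgt lt_i.
Qed.

(* The ring R[[x]], with the Cauchy product. *)

Record fps (R : Type) : Type := Fps { fps_coef : nat -> R }.

HB.instance Definition _ (R : Type) := [isNew for @fps_coef R].
HB.instance Definition _ (R : choiceType) := [Choice of fps R by <:].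

Lemma fpsP (R : Type) (f g : fps R) :
  (forall n, fps_coef f n = fps_coef g n) <-> f = g.
Proof. by split=> [|->//]; case: f g => [f] [g] /= /funext ->. Qed.

Definition fps_zero (R : nmodType) : fps R := Fps (fun _ => 0).
Definition fps_opp (R : zmodType) (f : fps R) : fps R :=
  Fps (fun n => - fps_coef f n).
Definition fps_add (R : nmodType) (f g : fps R) : fps R :=
  Fps (fun n => fps_coef f n + fps_coef g n).
Definition fps_one (R : nzRingType) : fps R := Fps (fun n => (n == 0%N)%:R).
Definition fps_mul (R : nzRingType) (f g : fps R) : fps R :=
  Fps (fun n => \sum_(i < n.+1) fps_coef f i * fps_coef g (n - i)).

Lemma fps_addA (R : zmodType) : associative (@fps_add R).
Proof. by move=> f g h; apply/fpsP => n /=; rewrite addrA. Qed.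
Lemma fps_addC (R : zmodType) : commutative (@fps_add R).
Proof. by move=> f g; apply/fpsP => n /=; rewrite addrC. Qed.
Lemma fps_add0 (R : zmodType) : left_id (fps_zero R) (@fps_add R).
Proof. by move=> f; apply/fpsP => n /=; rewrite add0r. Qed.
Lemma fps_addN (R : zmodType) :
  left_inverse (fps_zero R) (@fps_opp R) (@fps_add R).
Proof. by move=> f; apply/fpsP => n /=; rewrite addNr. Qed.

HB.instance Definition _ (R : zmodType) := GRing.isZmodule.Build (fps R)
  (@fps_addA R) (@fps_addC R) (@fps_add0 R) (@fps_addN R).

Definition fps_trunc (R : nzRingType) (N : nat) (f : fps R) : {poly R} :=
  \poly_(i < N) fps_coef f i.

Lemma fps_mul_trunc (R : nzRingType) (N n : nat) (f g : fps R) : (n < N)%N ->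
  fps_coef (fps_mul f g) n = (fps_trunc N f * fps_trunc N g)`_n.
Proof.
move=> nN; rewrite coefM; apply: eq_bigr => i _; rewrite !coef_poly.
by rewrite (leq_ltn_trans _ nN) ?leq_ord // (leq_ltn_trans (leq_subr _ _) nN).
Qed.

Lemma fps_mulA (R : comNzRingType) : associative (@fps_mul R).
Proof.
move=> f g h; apply/fpsP => n.
rewrite !(@fps_mul_trunc _ n.+1 n) //.
transitivity (fps_trunc n.+1 f * (fps_trunc n.+1 g * fps_trunc n.+1 h))`_n.
  rewrite !coefM; apply: eq_bigr => i _; congr (_ * _).
  by rewrite coef_poly ltnS leq_subr (@fps_mul_trunc _ n.+1) // ltnS leq_subr.
rewrite mulrA !coefM; apply: eq_bigr => i _; congr (_ * _).
by rewrite [RHS]coef_poly ltn_ord (@fps_mul_trunc _ n.+1).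
Qed.

Lemma fps_mulC (R : comNzRingType) : commutative (@fps_mul R).
Proof.
by move=> f g; apply/fpsP => n; rewrite !(@fps_mul_trunc _ n.+1 n) // mulrC.
Qed.

Lemma fps_mul1 (R : comNzRingType) : left_id (fps_one R) (@fps_mul R).
Proof.
move=> f; apply/fpsP => n /=; rewrite big_ord_recl /= mul1r subn0.
by rewrite big1 ?addr0 // => i _; rewrite mul0r.
Qed.

Lemma fps_mulDl (R : comNzRingType) :
  left_distributive (@fps_mul R) (@fps_add R).
Proof.
move=> f g h; apply/fpsP => n /=; rewrite -big_split /=.
by apply: eq_bigr => i _; rewrite mulrDl.
Qed.

Lemma fps_one_neq0 (R : comNzRingType) : fps_one R != 0.
Proof.
apply/eqP => /fpsP /(_ 0%N) /= /eqP.
by rewrite oner_eq0.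
Qed.

HB.instance Definition _ (R : comNzRingType) :=
  GRing.Zmodule_isComNzRing.Build (fps R)
    (@fps_mulA R) (@fps_mulC R) (@fps_mul1 R) (@fps_mulDl R)
    (@fps_one_neq0 R).

(* f^-1 is the g such that g * f = 1 when there is one; otherwise it is f, as
   the unitRingType interface requires. *)
Definition fps_unit (R : comNzRingType) (f : fps R) : bool :=
  `[< exists g : fps R, g * f = 1 >].
Definition fps_inv (R : comNzRingType) (f : fps R) : fps R :=
  match pselect (exists g : fps R, g * f = 1) with
  | left e => projT1 (cid e)
  | right _ => f
  end.

Lemma fps_mulVx (R : comNzRingType) :
  {in @fps_unit R, left_inverse 1 (@fps_inv R) *%R}.
Proof.
move=> f /asboolP uf; rewrite /fps_inv; case: pselect => // e.
exact: projT2 (cid e).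
Qed.

Lemma fps_unitPl (R : comNzRingType) (f g : fps R) : g * f = 1 -> fps_unit f.
Proof. by move=> gf; apply/asboolP; exists g. Qed.

Lemma fps_inv_out (R : comNzRingType) :
  {in [predC @fps_unit R], @fps_inv R =1 id}.
Proof.
move=> f /negP nuf; rewrite /fps_inv; case: pselect => // e.
by case: nuf; apply/asboolP.
Qed.

HB.instance Definition _ (R : comNzRingType) :=
  GRing.ComNzRing_hasMulInverse.Build (fps R)
    (@fps_mulVx R) (@fps_unitPl R) (@fps_inv_out R).

Definition fps_X (R : nzRingType) : fps R := Fps (fun n => (n == 1%N)%:R).

(* Coefficients of f^-1, used to show that f is a unit when f(0) is; so the
   inverse of 1 - x - ... - x^m is a genuine one. *)
Fixpoint fps_inv_seq (R : comUnitRingType) (f : fps R) (n : nat) : seq R :=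
  if n is n'.+1 then
    let s := fps_inv_seq f n' in
    rcons s ((fps_coef f 0%N)^-1 *
             ((n' == 0%N)%:R - \sum_(i < n') s`_i * fps_coef f (n' - i)))
  else [::].

Lemma fps_unit_coef0 (R : comUnitRingType) (f : fps R) :
  fps_coef f 0%N \is a GRing.unit -> f \is a GRing.unit.
Proof.
move=> u; pose s := fps_inv_seq f.
have sz n : size (s n) = n by elim: n => //= n IH; rewrite size_rcons IH.
have stab i n : (i < n)%N -> (s n)`_i = (s i.+1)`_i.
  elim: n => // n IH; rewrite ltnS leq_eqVlt => /orP[/eqP->//|lin].
  by rewrite -IH //= nth_rcons sz lin.
apply: (@fps_unitPl _ _ (Fps (fun n => (s n.+1)`_n))); apply/fpsP => n /=.
rewrite big_ord_recr /= subnn nth_rcons sz ltnn eqxx mulrC mulVKr //.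
rewrite addrC -[RHS](subrK (\sum_(i < n) (s n)`_i * fps_coef f (n - i))).
by congr (_ + _); apply: eq_bigr => i _; rewrite (stab i n).
Qed.

Definition genfun (a : nat -> nat) : fps rat := Fps (fun n => (a n)%:R).

(* Main.v *)
Require Import Defs.
From mathcomp Require Import all_boot all_order all_algebra all_fingroup.
From mathcomp Require Import boolp zify.
Import GRing.Theory Num.Theory.
Local Open Scope ring_scope.

(** If a permutation of [0, n) avoids 132 and 213 and starts with the value y,
    then the values above y occur in increasing order (132) and before all
    values below y (213). Hence its word is y, y+1, ..., n-1 followed by a
    permutation of [0, y) avoiding the same patterns. An increasing subsequence
    stays inside one such block, so avoiding 12...k bounds the block lengths by
    k-1. Removing a first block of length j gives a(n) = sum_(0 < j < k) a(n - j),
    which is the recurrence of F_{k-1,n+1} and the coefficientwise form of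
    f * (1 - x - ... - x^(k-1)) = 1. *)

(** * Subsequences and sorted lists *)

Lemma subseq_catP (T : eqType) (t s1 s2 : seq T) :
  subseq t (s1 ++ s2) ->
  exists t1 t2, [/\ t = t1 ++ t2, subseq t1 s1 & subseq t2 s2].
Proof.
elim: s1 t => [|x s1 IH] [|y t] /=.
- by move=> _; exists [::], [::]; rewrite sub0seq.
- by move=> ts; exists [::], (y :: t).
- by move=> _; exists [::], [::]; rewrite !sub0seq.
case: eqP => [->|/eqP neq_yx] /IH[t1 [t2 [eq_t sub1 sub2]]].
  by exists (x :: t1), t2; rewrite eq_t /= eqxx.
exists t1, t2; split=> //; exact: subseq_trans sub1 (subseq_cons _ _).
Qed.

Lemma pairwise_subseq2 (T : eqType) (r : rel T) (s : seq T) :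
  (forall u v, subseq [:: u; v] s -> r u v) -> pairwise r s.
Proof.
elim: s => //= x s IH rs; apply/andP; split.
  by apply/allP => v sv; apply: rs; rewrite eqxx sub1seq.
apply: IH => u v suv; apply: rs.
exact: subseq_trans suv (subseq_cons s x).
Qed.

(** A list sorted for a strict order is determined by its set of entries, so [t] must equal [s]
    filtered by membership in [t]. *)
Lemma sorted_sub_subseq (T : eqType) (r : rel T) (t s : seq T) :
  transitive r -> irreflexive r -> sorted r t -> sorted r s ->
  {subset t <= s} -> subseq t s.
Proof.
move=> r_tr r_irr st ss ts; rewrite (_ : t = filter (mem t) s) ?filter_subseq //.
apply: (irr_sorted_eq r_tr r_irr) => //; first exact: sorted_filter.
by move=> z; rewrite mem_filter /=; case: (boolP (z \in t)) => // /ts ->.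
Qed.

(** The second hypothesis is avoidance of 213 when [y] is put in front of [s] and plays the 2. *)
Lemma split_at_value (y : nat) (s : seq nat) : y \notin s ->
  (forall u v, subseq [:: u; v] s -> ~~ (u < y < v)%N) ->
  s = [seq z <- s | (y < z)%N] ++ [seq z <- s | (z < y)%N].
Proof.
elim: s => // x s IH; rewrite inE negb_or => /andP[neq_yx y_s] av.
have {}IH : s = [seq z <- s | (y < z)%N] ++ [seq z <- s | (z < y)%N].
  by apply: IH => // u v suv; apply/av/(subseq_trans suv)/subseq_cons.
rewrite /=; case: (ltngtP y x) => [lt_yx|lt_xy|eq_yx] /=.
- by rewrite -IH.
(* After an entry [x < y] no entry may exceed [y], so the first filter is empty and [x] starts the
   second one. *)
- have nil : [seq z <- s | (y < z)%N] = [::].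
    apply/eqP; rewrite -[_ == _]negbK -has_filter; apply/hasPn => v sv.
    by have := av x v; rewrite /= eqxx sub1seq lt_xy => /(_ sv).
  by rewrite nil /=; move: IH; rewrite nil /= => <-.
by rewrite eq_yx eqxx in neq_yx.
Qed.

(** * Avoidance for words and the splitting off of the first block *)

Definition avoids132 (s : seq nat) : Prop :=
  forall a b c, subseq [:: a; b; c] s -> ~~ (a < c < b)%N.
Definition avoids213 (s : seq nat) : Prop :=
  forall a b c, subseq [:: a; b; c] s -> ~~ (b < a < c)%N.
Definition increasing_lt (k : nat) (s : seq nat) : Prop :=
  forall t, subseq t s -> sorted ltn t -> (size t < k)%N.

(** A classical truth value, so that the three conditions can filter a finite list. *)
Definition good (k : nat) (s : seq nat) : bool :=
  `[< [/\ increasing_lt k s, avoids132 s & avoids213 s] >].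

(** The block is increasing and lies entirely above [s], so a subsequence meeting both parts ends
    below its first entry. It is therefore neither increasing nor an occurrence of 132 or 213, and
    each condition can be checked on the two parts separately. *)
Lemma good_block_cat (k x j : nat) (s : seq nat) :
  {in s, forall y, (y < x)%N} ->
  good k (iota x j ++ s) = (j < k)%N && good k s.
Proof.
move=> lt_sx; apply/asboolP/andP.
  case=> inc a132 a213; split.
    have := inc _ (prefix_subseq (iota x j) s) (iota_ltn_sorted x j).
    by rewrite size_iota.
  have sub t : subseq t s -> subseq t (iota x j ++ s).
    by move=> ts; apply/(subseq_trans ts)/suffix_subseq.
  apply/asboolP; split.
  - by move=> t /sub; apply: inc.
  - by move=> a b c /sub; apply: a132.
  by move=> a b c /sub; apply: a213.
case=> lt_jk /asboolP[inc a132 a213].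
have blockP t1 : subseq t1 (iota x j) ->
    sorted ltn t1 /\ {in t1, forall y, (x <= y)%N}.
  move=> sub1; split; first exact: (subseq_sorted ltn_trans sub1 (iota_ltn_sorted _ _)).
  by move=> y /(mem_subseq sub1); rewrite mem_iota => /andP[].
(* The three cases are: inside [s], across both parts, inside the block. The last two contradict
   both 132 and 213. *)
have tripleP a b c : subseq [:: a; b; c] (iota x j ++ s) ->
    [\/ subseq [:: a; b; c] s, (c < a)%N | (a < b < c)%N].
  case/subseq_catP=> -[|u t1] [t2 [eq_t sub1 sub2]].
    by apply: Or31; rewrite eq_t.
  case: t2 => [|y t2] in eq_t sub2 *.
    apply: Or33; rewrite cats0 in eq_t.
    by have [+ _] := blockP _ sub1; rewrite -eq_t /= andbT.
  apply: Or32; have [_ /(_ u (mem_head _ _))] := blockP _ sub1.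
  have /(mem_subseq sub2)/lt_sx : c \in y :: t2.
    by move: (congr1 (last 0%N) eq_t); rewrite last_cat /= => ->; apply: mem_last.
  by case: eq_t => -> _; lia.
split.
- move=> t /subseq_catP[t1 [t2 [-> sub1 sub2]]].
  case: t1 sub1 => [_|z t1 sub1]; first exact: inc.
  case: t2 sub2 => [_|y t2 sub2 /=].
    by rewrite cats0 => _; have := size_subseq sub1; rewrite size_iota; lia.
  rewrite (path_sortedE ltn_trans) all_cat /= => /andP[/andP[_ /andP[lt_zy _]] _].
  have /lt_sx lt_yx : y \in s by apply: (mem_subseq sub2); rewrite mem_head.
  have [_ /(_ z (mem_head _ _))] := blockP _ sub1; lia.
- by move=> a b c /tripleP[/a132||] //; lia.
by move=> a b c /tripleP[/a213||] //; lia.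
Qed.

(** With [y] as the 2 of 213, larger entries precede smaller ones; with [y] as the 1 of 132, the
    larger ones increase. Since every value below [n] occurs, the larger ones are exactly the
    interval from [y.+1] to [n - 1]. *)
Lemma first_block (n y : nat) (s : seq nat) :
  perm_eq (y :: s) (iota 0 n) -> avoids132 (y :: s) -> avoids213 (y :: s) ->
  y :: s = iota y (n - y) ++ [seq z <- s | (z < y)%N].
Proof.
move=> perm_s a132 a213.
have mem_s z : (z == y) || (z \in s) = (z < n)%N.
  by rewrite -in_cons (perm_mem perm_s) mem_iota.
have lt_yn : (y < n)%N by rewrite -mem_s eqxx.
have /andP[y_s uniq_s] : uniq (y :: s) by rewrite (perm_uniq perm_s) iota_uniq.
have eq_s := split_at_value y s y_s.
rewrite {1}eq_s; last first.
  move=> u v suv; apply: contra (a213 y u v _); first by [].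
  by rewrite /= eqxx.
(* Exposes [y] as the head of the block; it remains to identify the filter with
   [iota y.+1 (n - y.+1)]. *)
rewrite -(subnSK lt_yn) /=; congr (_ :: _ ++ _).
apply: (irr_sorted_eq ltn_trans ltnn).
- apply/pairwise_sorted/pairwise_subseq2 => u v suv.
  have sub_s : subseq [:: u; v] s by apply/(subseq_trans suv)/filter_subseq.
  have : uniq [:: u; v] by apply: (subseq_uniq sub_s).
  have /allP/(_ v) : all (fun z => y < z)%N [:: u; v].
    apply/allP => z /(mem_subseq suv); rewrite mem_filter => /andP[] //.
  have := a132 y u v; rewrite /= eqxx => /(_ sub_s).
  by rewrite !inE eqxx orbT => + /(_ isT); lia.
- exact: iota_ltn_sorted.
move=> z; rewrite mem_filter mem_iota subnKC //.
by case: (ltnP y z) => //= lt_yz; rewrite -mem_s gtn_eqF.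
Qed.

(** * The recurrence for the number of good words *)

Definition good_words (k n : nat) : seq (seq nat) :=
  [seq s <- permutations (iota 0 n) | good k s].

Lemma mem_good_words (k n : nat) (s : seq nat) :
  (s \in good_words k n) = good k s && perm_eq s (iota 0 n).
Proof. by rewrite mem_filter mem_permutations. Qed.

Lemma good_words_lt (k n : nat) (s : seq nat) :
  s \in good_words k n -> {in s, forall y, (y < n)%N}.
Proof.
by rewrite mem_good_words => /andP[_ ps] y; rewrite (perm_mem ps) mem_iota.
Qed.

(** Each good word arises once from the length [j] of its first block, made of the [j] largest
    values, and a good word on the values below [n - j]. *)
Lemma good_words_rec (k n : nat) : (0 < n)%N ->
  perm_eq (good_words k n)
    [seq iota (n - j) j ++ s | j <- [seq j <- index_iota 1 k | (j <= n)%N],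
                               s <- good_words k (n - j)].
Proof.
move=> n_gt0; apply: uniq_perm.
- exact/filter_uniq/permutations_uniq.
- apply: allpairs_uniq_dep.
  + exact/filter_uniq/iota_uniq.
  + by move=> j _; apply/filter_uniq/permutations_uniq.
  move=> _ _ /allpairsPdep[i [s [+ _ ->]]] /allpairsPdep[j [t [+ _ ->]]] /=.
  rewrite !mem_filter !mem_index_iota => /andP[le_in /andP[i_gt0 _]].
  move=> /andP[le_jn /andP[j_gt0 _]] eq_st.
  (* Both blocks are nonempty, so the common head of the two words is [n - i] and also [n - j]. *)
  have eq_ij : i = j.
    by move: (congr1 (head 0%N) eq_st); case: i j i_gt0 j_gt0 le_in le_jn {eq_st} => [|i] [|j] //=; lia.
  rewrite -eq_ij in eq_st *.
  by move/eqP: eq_st; rewrite eqseq_cat // eqxx => /eqP->.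
move=> w; apply/idP/allpairsPdep.
  rewrite mem_good_words => /andP[good_w perm_w].
  case: w good_w perm_w => [_ /perm_size|y s good_w perm_w].
    by rewrite size_iota => eq_n; rewrite -eq_n in n_gt0.
  have /asboolP[_ a132 a213] := good_w.
  have eq_w := first_block _ _ _ perm_w a132 a213.
  have lt_yn : (y < n)%N by have := mem_head y s; rewrite (perm_mem perm_w) mem_iota.
  have lt_t : {in [seq z <- s | (z < y)%N], forall z, (z < y)%N}.
    by move=> z; rewrite mem_filter => /andP[].
  move: good_w perm_w; rewrite eq_w good_block_cat // => /andP[lt_k good_t].
  (* Write [iota 0 n] as [iota 0 y] followed by the block, then cancel the block. *)
  rewrite -[X in iota 0 X](subnKC (ltnW lt_yn)) iotaD perm_catC perm_cat2r => perm_t.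
  exists (n - y)%N, [seq z <- s | (z < y)%N].
  rewrite mem_filter mem_index_iota mem_good_words subKn ?(ltnW lt_yn) //.
  by rewrite good_t perm_t lt_k leq_subr subn_gt0 lt_yn.
case=> j [s [+ s_in ->]]; rewrite mem_filter mem_index_iota.
move=> /and3P[le_jn j_gt0 lt_jk]; have lt_s := good_words_lt _ _ _ s_in.
move: s_in; rewrite !mem_good_words good_block_cat // lt_jk => /andP[-> perm_s].
by rewrite -[X in iota 0 X](subnK le_jn) iotaD perm_catC perm_cat2r.
Qed.

Lemma size_good_words0 (k : nat) : (0 < k)%N -> size (good_words k 0) = 1%N.
Proof.
move=> k_gt0; rewrite (perm_size (uniq_perm (s2 := [:: [::]]) _ _ _)) //.
  exact/filter_uniq/permutations_uniq.
move=> s; rewrite mem_good_words inE.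
case: s => [|y s]; last by apply/negP => /andP[_ /perm_size].
rewrite perm_refl andbT eqxx; apply/asboolP; split=> //.
by move=> t; rewrite subseq0 => /eqP->.
Qed.

Lemma size_good_words_rec (k n : nat) : (0 < n)%N ->
  size (good_words k n)
  = (\sum_(1 <= j < k | (j <= n)%N) size (good_words k (n - j)))%N.
Proof.
move=> n_gt0; rewrite (perm_size (good_words_rec _ _ n_gt0)).
by rewrite size_allpairs_dep sumnE big_map big_filter.
Qed.

Lemma size_good_words (k n : nat) : (2 <= k)%N ->
  size (good_words k n) = gfib k.-1 (n%:Z + 1).
Proof.
move=> k_ge2; elim/ltn_ind: n => n IH.
case: (posnP n) => [->|n_gt0]; first by rewrite size_good_words0 ?add0r //; lia.
rewrite size_good_words_rec // gfib_rec; last by lia.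
rewrite prednK; last by lia.
rewrite big_mkcond; apply: eq_big_nat => j /andP[j_gt0 _].
case: (leqP j n) => [le_jn|lt_nj].
  rewrite IH; last by lia.
  by congr gfib; lia.
(* For [j > n] the index [n + 1 - j] is at most 0, so the terms missing from the count vanish in the
   Fibonacci sum as well. *)
by rewrite gfib_le0 //; lia.
Qed.

(** * Permutations as words, and patterns as subsequences *)

Definition word (n : nat) (pi : 'S_n) : seq nat := [seq val (pi i) | i <- enum 'I_n].

Lemma nth_word (n : nat) (pi : 'S_n) (i : 'I_n) : nth 0%N (word n pi) i = pi i.
Proof. by rewrite (nth_map i) ?size_enum_ord // nth_ord_enum. Qed.

Lemma word_inj (n : nat) : injective (word n).
Proof.
move=> pi rho eq_w; apply/permP => i; apply/val_inj.
by rewrite /= -!nth_word eq_w.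
Qed.

Lemma perm_word (n : nat) (pi : 'S_n) : perm_eq (word n pi) (iota 0 n).
Proof.
apply: uniq_perm; first 1 last.
- exact: iota_uniq.
- move=> z; rewrite mem_iota; apply/mapP/idP => [[i _ ->] //=|lt_zn].
  by exists ((pi^-1)%g (Ordinal lt_zn)); rewrite ?mem_enum // permKV.
rewrite map_inj_uniq ?enum_uniq // => i j /val_inj; exact: perm_inj.
Qed.

Lemma word_surj (n : nat) (s : seq nat) :
  perm_eq s (iota 0 n) -> exists pi : 'S_n, word n pi = s.
Proof.
move=> perm_s; have sz_s : size s = n by rewrite (perm_size perm_s) size_iota.
have lt_s (i : 'I_n) : (nth 0%N s i < n)%N.
  have : nth 0%N s i \in s by rewrite mem_nth ?sz_s.
  by rewrite (perm_mem perm_s) mem_iota.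
have f_inj : injective (fun i : 'I_n => Ordinal (lt_s i)).
  move=> i j [/eqP]; rewrite nth_uniq ?sz_s //; first by move/eqP/val_inj.
  by rewrite (perm_uniq perm_s) iota_uniq.
exists (perm f_inj); apply: (@eq_from_nth _ 0%N).
  by rewrite size_map size_enum_ord.
rewrite size_map size_enum_ord => i lt_in.
by rewrite -[i]/(val (Ordinal lt_in)) nth_word permE.
Qed.

(** An occurrence is passed from increasing positions to the subsequence of values found there,
    which is the form used for words. *)
Lemma containsP (n m : nat) (pi : 'S_n) (sigma : 'S_m) :
  reflect (exists t, [/\ subseq t (word n pi), size t = m &
             forall a b : 'I_m, (nth 0 t a < nth 0 t b)%N = (sigma a < sigma b)%N])
          (contains pi sigma).
Proof.
pose r : rel 'I_n := fun i j => (i < j)%N.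
have r_tr : transitive r by move=> j i l; apply: ltn_trans.
have r_irr : irreflexive r by move=> i; apply: ltnn.
have r_enum p : sorted (fun i j : 'I_p => (i < j)%N) (enum 'I_p).
  by have := iota_ltn_sorted 0 p; rewrite -val_enum_ord sorted_map.
apply: (iffP existsP).
  case=> i /andP[/'forall_forallP i_inc /'forall_forallP i_iso].
  exists [seq val (pi (i a)) | a <- enum 'I_m]; split.
  - rewrite (map_comp (fun j => val (pi j)) i); apply: map_subseq.
    apply: (sorted_sub_subseq _ _ _ _ r_tr r_irr _ (r_enum n)).
      apply: (homo_sorted _ _ (r_enum m)) => a b lt_ab.
      exact: (implyP (i_inc a b)).
    by move=> j _; rewrite mem_enum.
  - by rewrite size_map size_enum_ord.
  move=> a b; rewrite !(nth_map a 0%N) ?size_enum_ord // !nth_ord_enum.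
  exact: (eqP (i_iso a b)).
case=> t [/subseqP[msk _ eq_t] sz_t iso].
(* The mask selecting [t] from the word, applied to the positions, recovers the indices of the
   occurrence. *)
pose e := mask msk (enum 'I_n).
have {}eq_t : t = [seq val (pi j) | j <- e] by rewrite eq_t -map_mask.
have sz_e : size e == m by rewrite -sz_t eq_t size_map.
have e_sorted : sorted r e.
  exact: (subseq_sorted r_tr (mask_subseq msk (enum 'I_n)) (r_enum n)).
exists [ffun a => tnth (Tuple sz_e) a]; apply/andP; split.
  apply/'forall_forallP => a b; apply/implyP => lt_ab; rewrite !ffunE.
  have x0 := tnth (Tuple sz_e) a; rewrite !(tnth_nth x0) /=.
  have /(sorted_ltn_nth r_tr) := e_sorted; apply=> //; by rewrite inE (eqP sz_e).
apply/'forall_forallP => a b; rewrite !ffunE -iso eq_t.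
have x := tnth (Tuple sz_e) a.
by rewrite !(nth_map x 0%N) ?(eqP sz_e) // !(tnth_nth x) eqxx.
Qed.

(** An increasing subsequence of length at least [k] has a prefix of length exactly [k], which is an
    occurrence of the identity pattern. *)
Lemma avoids_idP (n k : nat) (pi : 'S_n) :
  reflect (increasing_lt k (word n pi)) (avoids pi (id_pattern k)).
Proof.
apply: (iffP negP) => [av t sub_t t_inc|inc /containsP[t [sub_t sz_t iso]]].
  rewrite ltnNge; apply/negP => le_kt; apply: av; apply/containsP.
  exists (take k t); split.
  - exact: subseq_trans (take_subseq _ _) sub_t.
  - exact: size_takel.
  move=> a b; rewrite !perm1 !nth_take //.
  have t_nth := sorted_ltn_nth ltn_trans 0%N t_inc.
  have in_t (i : 'I_k) : val i \in [pred i | (i < size t)%N].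
    by rewrite inE (leq_trans (ltn_ord i)).
  case: (ltngtP a b) => [lt_ab|lt_ba|eq_ab].
  - exact: (t_nth _ _ (in_t a) (in_t b) lt_ab).
  - by have := t_nth _ _ (in_t b) (in_t a) lt_ba; rewrite /=; lia.
  by rewrite eq_ab ltnn.
suff t_inc : sorted ltn t by have := inc t sub_t t_inc; rewrite sz_t ltnn.
apply/(sortedP 0%N) => i lt_i.
have lt_ik : (i.+1 < k)%N by rewrite -sz_t.
by have := iso (Ordinal (ltnW lt_ik)) (Ordinal lt_ik); rewrite !perm1 /= ltnSn.
Qed.

(** Comparing entries of [one_line sigma] instead of values of [sigma] is harmless, since the shift
    by one preserves order, and it allows the explicit words of 132 and 213 to be substituted. *)
Lemma avoids3P (n : nat) (pi : 'S_n) (sigma : 'S_3) :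
  reflect (forall a b c, subseq [:: a; b; c] (word n pi) ->
             ~ forall i j : 'I_3,
                 (nth 0 [:: a; b; c] i < nth 0 [:: a; b; c] j)%N
                 = (nth 0 (one_line sigma) i < nth 0 (one_line sigma) j)%N)
          (avoids pi sigma).
Proof.
have sigmaE (i j : 'I_3) :
    (nth 0 (one_line sigma) i < nth 0 (one_line sigma) j)%N = (sigma i < sigma j)%N.
  by rewrite /one_line !(nth_map i 0%N) ?size_enum_ord // !nth_ord_enum.
apply: (iffP negP) => [av a b c sub_t iso|av /containsP[t [sub_t sz_t iso]]].
  by apply: av; apply/containsP; exists [:: a; b; c]; split=> // i j; rewrite iso.
case: t sz_t sub_t iso => [|a [|b [|c [|? ?]]]] // _ sub_t iso.
by apply: (av a b c) => // i j; rewrite iso.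
Qed.

Lemma avoids132P (n : nat) (pi : 'S_n) :
  reflect (avoids132 (word n pi)) (avoids pi perm132).
Proof.
apply: (iffP (avoids3P _ _ _)) => av a b c sub_t.
  apply/negP => lt_acb; apply: (av a b c sub_t); rewrite perm132_one_line.
  by move=> [[|[|[|i]]] lt_i] [[|[|[|j]]] lt_j] //=; lia.
rewrite perm132_one_line => iso; have /negP := av a b c sub_t; apply.
(* These two index pairs give [a < c] and [c < b]. *)
have := iso (inord 0) (inord 2); have := iso (inord 2) (inord 1).
by rewrite !inordK //= => -> ->.
Qed.

Lemma avoids213P (n : nat) (pi : 'S_n) :
  reflect (avoids213 (word n pi)) (avoids pi perm213).
Proof.
apply: (iffP (avoids3P _ _ _)) => av a b c sub_t.
  apply/negP => lt_bac; apply: (av a b c sub_t); rewrite perm213_one_line.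
  by move=> [[|[|[|i]]] lt_i] [[|[|[|j]]] lt_j] //=; lia.
rewrite perm213_one_line => iso; have /negP := av a b c sub_t; apply.
have := iso (inord 1) (inord 0); have := iso (inord 0) (inord 2).
by rewrite !inordK //= => -> ->.
Qed.

Lemma card_Av (k n : nat) :
  #|Av n%:Z [:: Pattern (id_pattern k); Pattern perm132; Pattern perm213]|
  = size (good_words k n).
Proof.
set A := Av _ _; rewrite cardE -(size_map (word n)); apply/perm_size/uniq_perm.
- by rewrite map_inj_uniq ?enum_uniq //; apply: word_inj.
- exact/filter_uniq/permutations_uniq.
have mem_A (pi : 'S_n) : (pi \in A) = good k (word n pi).
  rewrite inE /= andbT; apply/and3P/asboolP.
    by case=> /avoids_idP ? /avoids132P ? /avoids213P ?.
  by case=> ? ? ?; split; [apply/avoids_idP|apply/avoids132P|apply/avoids213P].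
move=> s; rewrite mem_good_words; apply/mapP/andP.
  by case=> pi; rewrite mem_enum mem_A => good_pi ->; split=> //; apply: perm_word.
case=> good_s /word_surj[pi eq_s]; exists pi => //.
by rewrite mem_enum mem_A eq_s.
Qed.

(** * Power series coefficients and the generating function *)

Lemma fps_coefB (R : comNzRingType) (f g : fps R) (n : nat) :
  fps_coef (f - g) n = fps_coef f n - fps_coef g n.
Proof. by []. Qed.

Lemma fps_coefM (R : comNzRingType) (f g : fps R) (n : nat) :
  fps_coef (f * g) n = \sum_(i < n.+1) fps_coef f i * fps_coef g (n - i).
Proof. by []. Qed.

Lemma fps_coef_sum (R : comNzRingType) (I : Type) (r : seq I) (P : pred I)
    (F : I -> fps R) (n : nat) :
  fps_coef (\sum_(i <- r | P i) F i) n = \sum_(i <- r | P i) fps_coef (F i) n.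
Proof. exact: (big_morph (fun f : fps R => fps_coef f n)). Qed.

Lemma fps_coef_mulXn (R : comNzRingType) (f : fps R) (i n : nat) :
  fps_coef (f * fps_X R ^+ i) n = if (i <= n)%N then fps_coef f (n - i) else 0.
Proof.
elim: i n => [|i IH] n; first by rewrite expr0 mulr1 subn0.
rewrite exprSr mulrA fps_coefM.
under eq_bigr => j _ do rewrite IH.
case: n => [|n]; first by rewrite big_ord1 /= mulr0.
(* Of the convolution only the term at index [n] survives, where the factor [fps_X] contributes its
   coefficient of degree 1. *)
rewrite !big_ord_recr /= subnn mulr0 addr0 subSnn mulr1 big1 ?add0r ?subSS //.
by move=> j _; rewrite (_ : (_ == 1)%N = false) ?mulr0 //; have := ltn_ord j; lia.
Qed.

Theorem theorem3p5 (k : nat) (hk : (2 <= k)%N) :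
  let R := [:: Pattern (id_pattern k); Pattern perm132; Pattern perm213] in
  let x := fps_X rat in
  (forall n : int, #|Av n R| = gfib k.-1 (n + 1))
  /\ genfun (fun n : nat => #|Av n%:Z R|)
     = 1 / (1 - \sum_(1 <= i < k) x ^+ i).
Proof.
move=> R x; split.
  case=> n; first by rewrite card_Av size_good_words.
  (* For negative [n] the index [n + 1] is at most 0, and [Av] is empty by its condition
     [0 <= n]. *)
  rewrite gfib_le0; last by lia.
  by apply/eqP; rewrite cards_eq0; apply/eqP/setP => pi; rewrite !inE.
set f := genfun _; set q := 1 - _.
have fq : f * q = 1.
  apply/fpsP => n; rewrite /q mulrBr mulr1 mulr_sumr fps_coefB fps_coef_sum.
  under eq_bigr => i _ do rewrite fps_coef_mulXn /= card_Av.
  rewrite /= card_Av; case: n => [|n].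
    rewrite size_good_words0; last by lia.
    rewrite big_nat big1 ?subr0 // => i /andP[i_gt0 _].
    by rewrite leqNgt i_gt0.
  (* In positive degree the vanishing of the coefficient is the recurrence itself. *)
  by rewrite size_good_words_rec // natr_sum big_mkcond subrr.
(* The series [f] is itself the witness that [q] is invertible, so the quotient is a genuine one. *)
have q_unit : q \is a GRing.unit by exact: (@fps_unitPl _ _ f).
by rewrite -fq mulrK.
Qed.
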